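(* There exists an absolute constant $c>0$ (not depending on $n,p,\sigma,\beta^*,t$) such that the following holds. For any $t>0$, if \[ \frac{p\log n+t}{n}\le c\,\sigma\qquad\text{and}\qquad \sigma\leq \frac{1}{\sqrt{6}}, \] then the data $(x_1,y_1),\dots,(x_n,y_n)$ are linearly separable with probability at most $4\exp(-t)$.
   Context: Let $n,p$ be positive integers with $p<n$, $\sigma>0$, and $\beta^*\in S^{p-1}=\{\beta\in\mathbb{R}^p:\|\beta\|_2=1\}$. Let $x\sim\mathcal N(0,I_p)$ and $\epsilon\sim\mathcal N(0,1)$ be independent, and $y=\mathrm{sign}(x^T\beta^*+\sigma\epsilon)\in\{-1,1\}$ (the null event where the argument is $0$ is ignored). The data $(x_1,y_1),\dots,(x_n,y_n)$ are i.i.d. copies of $(x,y)$. $\log$ is the natural logarithm. The data are called linearly separable if there exists $\gamma\in\mathbb{R}^p$ such that $y_ix_i^T\gamma>0$ for all $i\in\{1,\dots,n\}$. *)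

(* Defs.v *)
From HB Require Import structures.
From mathcomp Require Import all_boot all_order all_algebra.
From mathcomp Require Import all_classical all_reals all_analysis.

Set Implicit Arguments.
Unset Strict Implicit.
Unset Printing Implicit Defensive.

Import Order.TTheory GRing.Theory Num.Theory.
Import numFieldNormedType.Exports.

Local Open Scope classical_set_scope.
Local Open Scope ring_scope.

(* Vectors of R^p are p.-tuple R, which carries the product (Borel)            *)
(* sigma-algebra; 'rV[R]_p has no measurable structure and its norm is the     *)
(* sup norm, hence the explicit dot product and Euclidean norm.                *)
Definition dot (R : realType) (p : nat) (u v : p.-tuple R) : R :=
  \sum_(j < p) tnth u j * tnth v j.

Definition norm2 (R : realType) (p : nat) (u : p.-tuple R) : R :=
  Num.sqrt (dot u u).

Definition independent2 (R : realType) (d d1 d2 : measure_display)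
    (T : measurableType d) (T1 : measurableType d1) (T2 : measurableType d2)
    (P : probability T R) (X : {RV P >-> T1}) (Y : {RV P >-> T2}) : Prop :=
  forall (A : set T1) (B : set T2), measurable A -> measurable B ->
    P (X @^-1` A `&` Y @^-1` B) = (P (X @^-1` A) * P (Y @^-1` B))%E.

Definition mutually_independent (R : realType) (d d' : measure_display)
    (T : measurableType d) (T' : measurableType d') (P : probability T R)
    (I : finType) (X : I -> T -> T') : Prop :=
  forall (J : {set I}) (A : I -> set T'), (forall i, measurable (A i)) ->
    P (\bigcap_(i in [set` J]) (X i @^-1` A i)) =
    (\prod_(i in J) P (X i @^-1` A i))%E.

Definition same_law (R : realType) (d1 d2 d' : measure_display)
    (T1 : measurableType d1) (T2 : measurableType d2) (T' : measurableType d')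
    (P1 : probability T1 R) (P2 : probability T2 R)
    (X1 : T1 -> T') (X2 : T2 -> T') : Prop :=
  forall A : set T', measurable A -> P1 (X1 @^-1` A) = P2 (X2 @^-1` A).

Definition iid_copies (R : realType) (d0 d d' : measure_display)
    (T0 : measurableType d0) (T : measurableType d) (T' : measurableType d')
    (P0 : probability T0 R) (P : probability T R)
    (X0 : T0 -> T') (I : finType) (X : I -> T -> T') : Prop :=
  mutually_independent P X /\ (forall i, same_law P P0 (X i) X0).

(* The second parameter of normal_prob is the standard deviation. *)
Definition std_normal (R : realType) (d : measure_display)
    (T : measurableType d) (P : probability T R) (X : T -> R) : Prop :=
  forall A : set R, measurable A -> P (X @^-1` A) = normal_prob 0 1 A.

(* N(0, I_p): the coordinates are mutually independent and N(0, 1). *)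
Definition std_normal_vector (R : realType) (d : measure_display)
    (T : measurableType d) (p : nat) (P : probability T R)
    (X : T -> p.-tuple R) : Prop :=
  mutually_independent P (fun (j : 'I_p) w => tnth (X w) j) /\
  (forall j : 'I_p, std_normal P (fun w => tnth (X w) j)).

(* Num.sg takes the value 0 at 0; under the Gaussian model this concerns only  *)
(* a null event, outside of which the label is in {-1, 1}.                     *)
Definition label (R : realType) (p : nat) (sigma : R) (beta x : p.-tuple R)
    (e : R) : R :=
  Num.sg (dot x beta + sigma * e).

Definition linearly_separable (R : realType) (n p : nat)
    (data : 'I_n -> p.-tuple R * R) : Prop :=
  exists gamma : p.-tuple R,
    forall i : 'I_n, 0 < (data i).2 * dot (data i).1 gamma.

(* Main.v *)
Require Import Defs.
From HB Require Import structures.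
From mathcomp Require Import all_boot all_order all_algebra.
From mathcomp Require Import all_classical all_reals all_analysis.
From mathcomp Require Import measurable_realfun.
From mathcomp Require Import ring lra zify.

Import Order.TTheory GRing.Theory Num.Theory.
Import numFieldNormedType.Exports.

Local Open Scope classical_set_scope.
Local Open Scope ring_scope.

(** A direction g is contradicted by a data point when y has the sign opposite
    to x.g. For every g this has probability at least of order sigma: the event
    |x.beta| <= sigma has probability of order sigma, since x.beta is standard
    normal, and on it a noise value outside ]-2, 2[ decides the label alone;
    being independent of x, the noise points against x.g with probability
    bounded below. Hence a fixed direction is consistent with n independent
    points with probability at most exp(- q n), where q is of order sigma; for c
    small enough the assumption makes this at most exp(- 16 (p log n + t)).

    A union bound over a finite set then replaces one direction by all of them.
    A separator can be scaled to sup norm 1 and its coordinates rounded down to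
    multiples of 1/n^2, which leaves at most (2 n^2 + 1)^p <= exp(4 p log n)
    grid points ([separable_grid], [grid_card_le]). Rounding moves x.g by at
    most eta |x|_1 with eta = 1/n^2, so a grid point g has to be contradicted
    with that margin ([margin_violated]). The margin costs only the probability
    of the thin cone |x.g| < eta |x|_1, which is at most 8p/n
    ([gaussian_thin_cone_le]); the assumption bounds it by half of the
    lower bound for the slab |x.beta| <= sigma ([gaussian_slab_ge]). The
    resulting lower bound for one direction is [margin_violated_ge].

    Both Gaussian estimates rest on the fact that x.g has law N(0, |g|^2)
    ([normal_law_dot]). It is proved one coordinate at a time: a partial sum is
    independent of the next coordinate ([mutually_independent_sum]), and the
    convolution of two centered normal laws is normal ([normal_law_add]). *)

(** * Affine changes of variables *)

Section affine_substitution.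
Context {R : realType}.
Notation mu := (@lebesgue_measure R).

Let affine (a b : R) (x : measurableTypeR R) : measurableTypeR R := a * x + b.

Let measurable_affine a b :
  measurable_fun [set: measurableTypeR R] (affine a b).
Proof. by apply: measurable_funD => //; exact: measurable_funM. Qed.

HB.instance Definition _ a b :=
  isMeasurableFun.Build _ _ _ _ (affine a b) (measurable_affine a b).

(** Two measures that agree on the half-open intervals are equal. *)
Lemma lebesgue_measure_affine (a b : R) (A : set R) : a != 0 -> measurable A ->
  mu A = (`|a|%:E * pushforward mu (affine a b) A)%E.
Proof.
move=> a0 mA.
pose k : {nonneg R} := NngNum (normr_ge0 a).
have /= := @lebesgue_measure_unique R (mscale k (pushforward mu (affine a b))).
apply => //.
move=> _ [[u v]] _ <-.
rewrite /mscale/= /pushforward.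
have [ap|an|] := ltgtP 0 a; last by move/esym/eqP; rewrite (negbTE a0).
  have -> : affine a b @^-1` `]u, v] = `](u - b) / a, (v - b) / a]%classic.
    apply/seteqP; split => x /=; rewrite !in_itv/= /affine;
    by rewrite ltr_pdivrMr// ler_pdivlMr// ltrBlDr lerBrDr mulrC.
  rewrite !lebesgue_measure_itv/= !lte_fin ltr_pM2r ?invr_gt0// ltrD2r.
  case: ifP => _; last by rewrite mule0.
  rewrite gtr0_norm// -!EFinB -EFinM; congr EFin; field.
  exact: a0.
have -> : affine a b @^-1` `]u, v] = `[(v - b) / a, (u - b) / a[%classic.
  apply/seteqP; split => x /=; rewrite !in_itv/= /affine;
  by rewrite ltr_ndivlMr// ler_ndivrMr// ltrBlDr lerBrDr mulrC andbC.
rewrite !lebesgue_measure_itv/= !lte_fin ltr_nM2r ?invr_lt0// ltrD2r.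
case: ifP => _; last by rewrite mule0.
rewrite ltr0_norm// -!EFinB -EFinM; congr EFin; field.
exact: a0.
Qed.

Lemma ge0_integral_affine (a b : R) (f : R -> \bar R) : a != 0 ->
  measurable_fun [set: R] f -> (forall x, 0 <= f x)%E ->
  (\int[mu]_x f x = \int[mu]_x (`|a|%:E * f (a * x + b)%R))%E.
Proof.
move=> a0 mf f0.
pose k : {nonneg R} := NngNum (normr_ge0 a).
have mfa : measurable_fun [set: measurableTypeR R] (f \o affine a b).
  by apply: measurableT_comp => //; exact: measurable_affine.
rewrite ge0_integralZl//= -(preimage_setT (affine a b)).
rewrite -(ge0_integral_pushforward (measurable_affine a b))//.
rewrite -(ge0_integral_mscale _ _ k)//.
by apply: eq_measure_integral => A mA _; exact: lebesgue_measure_affine.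
Qed.

End affine_substitution.

(** * Normal densities *)

Section normal_lemmas.
Context {R : realType}.
Notation mu := (@lebesgue_measure R).

(** The density [normal_pdf] is almost everywhere the Radon-Nikodym derivative
    of [normal_prob], so integrals against the law are Lebesgue integrals. *)
Lemma ge0_integral_normal_prob (m s : R) (f : R -> \bar R) :
  measurable_fun [set: R] f -> (forall x, 0 <= f x <= 1)%E ->
  (\int[normal_prob m s]_x f x =
   \int[mu]_x (f x * (normal_pdf m s x)%:E))%E.
Proof.
move=> mf f01.
have intf : (normal_prob m s).-integrable [set: measurableTypeR R] f.
  apply: (@le_integrable _ _ _ (normal_prob m s) _ measurableT _ (cst 1%E)) => //.
    by move=> x _ /=; have /andP[f0 f1] := f01 x; rewrite gee0_abs// normr1.
  exact: finite_measure_integrable_cst.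
rewrite -(Radon_Nikodym_change_of_variables (normal_prob_dominates m s))//=.
apply: ae_eq_integral => //.
- apply: emeasurable_funM => //; apply: (measurable_int mu).
  by apply: Radon_Nikodym_integrable; exact: normal_prob_dominates.
- apply: emeasurable_funM => //=; apply/measurable_EFinP.
  exact: measurable_normal_pdf.
- apply: ae_eqe_mul2l => /=.
  rewrite Radon_NikodymE//=; first exact: normal_prob_dominates.
  move=> ?; case: cid => /= h [h1 h2 h3].
  apply: integral_ae_eq => //=.
  + by apply/measurable_EFinP; exact: measurable_normal_pdf.
  + by move=> E E01 mE; rewrite -h3.
Qed.

Lemma normal_prob_indic (m s : R) (A : set R) : measurable A ->
  normal_prob m s A = (\int[mu]_x (\1_A x * normal_pdf m s x)%:E)%E.
Proof.
move=> mA; rewrite /normal_prob integral_mkcond; apply: eq_integral => x _.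
by rewrite patchE indicE; case: ifPn => _; rewrite ?mul1r ?mul0r.
Qed.

Lemma normal_peakM (s c : R) : 0 < s -> 0 < c ->
  normal_peak s * normal_peak 1 = normal_peak c * normal_peak (s / c).
Proof.
move=> s0 c0; rewrite /normal_peak -!invfM; congr (_^-1).
rewrite -!sqrtrM ?pmulrn_lge0 ?mulr_ge0 ?sqr_ge0 ?pi_ge0 ?ltW//.
by congr Num.sqrt; field; rewrite gt_eqF.
Qed.

(** Bayes formula for normal densities: the joint density of the pair made of
    an N(0, 1) variable y and z = u + a y, u of law N(0, s^2), factors as the
    density of z times the conditional density of y given z. Completing the
    square in y gives the mean and the standard deviation of the latter. *)
Lemma normal_pdf_complete_square (s a c z y : R) : 0 < s -> 0 < c ->
  c ^+ 2 = s ^+ 2 + a ^+ 2 ->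
  normal_pdf 0 s (z - a * y) * normal_pdf 0 1 y =
  normal_pdf 0 c z * normal_pdf (a * z / c ^+ 2) (s / c) y.
Proof.
move=> s0 c0 cE.
rewrite !normal_pdfE ?gt_eqF// ?divr_gt0// /normal_fun.
rewrite mulrACA (normal_peakM s c)// [RHS]mulrACA -!expRD; congr (_ * expR _).
have a2E : a ^+ 2 = c ^+ 2 - s ^+ 2 by rewrite cE addrC addKr.
rewrite -!(mulr_natr (_ ^+ 2)); apply/eqP; rewrite -subr_eq0; apply/eqP.
have -> : - (z - a * y - 0) ^+ 2 / (s ^+ 2 * 2%:R) + - (y - 0) ^+ 2 / (1 ^+ 2 * 2%:R) -
  (- (z - 0) ^+ 2 / (c ^+ 2 * 2%:R) + - (y - a * z / c ^+ 2) ^+ 2 / ((s / c) ^+ 2 * 2%:R)) =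
  (c ^+ 2 - s ^+ 2 - a ^+ 2) * (y ^+ 2 / (2 * s ^+ 2) - z ^+ 2 / (2 * s ^+ 2 * c ^+ 2)).
  by field; rewrite !gt_eqF//.
by rewrite a2E subrr mul0r.
Qed.

Lemma normal_pdf_scale (a x : R) : a != 0 ->
  `|a| * normal_pdf 0 `|a| (a * x) = normal_pdf 0 1 x.
Proof.
move=> a0; have a0' : 0 < `|a| by rewrite normr_gt0.
rewrite !normal_pdfE ?oner_neq0 ?gt_eqF// /normal_fun mulrA; congr (_ * expR _).
  rewrite /normal_peak -mulrnAr sqrtrM ?sqr_ge0// sqrtr_sqr normr_id invfM.
  by rewrite mulrA divff ?gt_eqF// mul1r expr1n mul1r.
rewrite !subr0 exprMn real_normK ?num_real// -!(mulr_natr (_ ^+ 2)).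
by field.
Qed.

End normal_lemmas.

(** * Convolution of normal laws *)

Section normal_law.
Context {R : realType} {d : measure_display} {T : measurableType d}
  (P : probability T R).
Notation mu := (@lebesgue_measure R).

Lemma normal_law_scale (X : T -> R) (a : R) : std_normal P X -> a != 0 ->
  forall A : set R, measurable A ->
  P ((fun w => a * X w) @^-1` A) = normal_prob 0 `|a| A.
Proof.
move=> nX a0 A mA.
have maA : measurable ((fun x : R => a * x) @^-1` A).
  by rewrite -[X in measurable X]setTI; exact: mulrl_measurable.
have -> : (fun w => a * X w) @^-1` A = X @^-1` ((fun x : R => a * x) @^-1` A).
  by [].
rewrite (nX _ maA).
rewrite (normal_prob_indic _ _ _ maA).
rewrite (normal_prob_indic _ _ _ mA).
rewrite [RHS](@ge0_integral_affine _ a 0 _ a0).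
- apply: eq_integral => x _; rewrite addr0 -EFinM; congr EFin.
  by rewrite mulrCA normal_pdf_scale.
- apply/measurable_EFinP; apply: measurable_funM.
    exact: measurable_indic.
  exact: measurable_normal_pdf.
- by move=> x; rewrite lee_fin mulr_ge0// normal_pdf_ge0.
Qed.

(** Both sides are written as Lebesgue integrals over the plane: the joint law is
    the product law by independence, the translation x = z - a y makes z the
    integration variable, and after exchanging the integrals
    [normal_pdf_complete_square] leaves in y a density of total mass 1. *)
Lemma normal_law_add (X Y : T -> R) (s a c : R) :
  measurable_fun [set: T] X -> measurable_fun [set: T] Y ->
  0 < s -> 0 < c -> c ^+ 2 = s ^+ 2 + a ^+ 2 ->
  (forall A : set R, measurable A -> P (X @^-1` A) = normal_prob 0 s A) ->
  std_normal P Y ->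
  (forall A B : set R, measurable A -> measurable B ->
    P (X @^-1` A `&` Y @^-1` B) = (P (X @^-1` A) * P (Y @^-1` B))%E) ->
  forall A : set R, measurable A ->
  P ((fun w => X w + a * Y w) @^-1` A) = normal_prob 0 c A.
Proof.
move=> mX mY s0 c0 cE nX nY indep A mA.
(* [normal_prob] lives on the Borel structure of [measurableTypeR R], whose
   display differs from that of [R]: the product is taken over the former. *)
pose RT := measurableTypeR R.
pose YX (w : T) : RT * RT := (Y w, X w).
have mYX : measurable_fun [set: T] YX by exact: (@measurable_fun_pair _ _ _ T RT RT).
pose g (yx : RT * RT) : RT := yx.2 + a * yx.1.
have mg : measurable_fun [set: RT * RT] g.
  apply: measurable_funD; first exact: measurable_snd.
  by apply: measurable_funM => //; exact: measurable_fst.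
have mgA : measurable (g @^-1` (A : set RT)).
  by rewrite -[X in measurable X]setTI; exact: mg.
have -> : (fun w => X w + a * Y w) @^-1` A = YX @^-1` (g @^-1` A) by [].
pose YXf : {mfun T >-> (RT * RT)%type} :=
  HB.pack YX (isMeasurableFun.Build _ _ _ _ _ mYX).
have law : forall A' B' : set RT, measurable A' -> measurable B' ->
    distribution P YXf (A' `*` B') = (normal_prob 0 1 A' * normal_prob 0 s B')%E.
  move=> A' B' mA' mB'; rewrite /distribution /pushforward.
  have -> : YXf @^-1` (A' `*` B') = X @^-1` B' `&` Y @^-1` A'.
    by apply/seteqP; split => w [].
  rewrite (indep _ _ mB' mA').
  rewrite (nX _ mB').
  rewrite (nY _ mA').
  exact: muleC.
have lawE : P (YX @^-1` (g @^-1` A)) =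
    (\int[normal_prob 0 1]_y normal_prob 0 s (xsection (g @^-1` A) y))%E.
  exact/esym/(@product_measure_unique _ _ _ _ _
    (normal_prob 0 1 : {sigma_finite_measure set RT -> \bar R})
    (normal_prob 0 s : {sigma_finite_measure set RT -> \bar R})
    (distribution P YXf) law (g @^-1` A) mgA).
rewrite lawE ge0_integral_normal_prob; last 2 first.
- exact: (@measurable_fun_xsection _ _ RT RT R
    (normal_prob 0 s : {sigma_finite_measure set RT -> \bar R}) _ mgA).
- move=> y; apply/andP; split; first exact: measure_ge0.
  exact/probability_le1/measurable_xsection.
pose f (yz : RT * RT) : \bar R :=
  (\1_A yz.2 * (normal_pdf 0 s (yz.2 - a * yz.1) * normal_pdf 0 1 yz.1))%:E.
have f0 yz : (0 <= f yz)%E.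
  by rewrite lee_fin !mulr_ge0// normal_pdf_ge0.
have mf : measurable_fun [set: RT * RT] f.
  apply/measurable_EFinP; apply: measurable_funM.
    by apply: measurableT_comp measurable_snd; exact: measurable_indic.
  apply: measurable_funM.
    apply: measurableT_comp; first exact: measurable_normal_pdf.
    apply: measurable_funB; first exact: measurable_snd.
    by apply: measurable_funM => //; exact: measurable_fst.
  by apply: measurableT_comp measurable_fst; exact: measurable_normal_pdf.
transitivity (\int[mu]_y \int[mu]_z f (y, z))%E.
  apply: eq_integral => y _.
  rewrite (normal_prob_indic _ _ _ (measurable_xsection y mgA)).
  have mh : measurable_fun [set: RT]
      (fun x => (\1_(xsection (g @^-1` A) y) x * normal_pdf 0 s x)%:E).
    apply/measurable_EFinP; apply: measurable_funM.
      exact/measurable_indic/measurable_xsection.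
    exact: measurable_normal_pdf.
  rewrite (@ge0_integral_affine _ 1 (- (a * y)) _ (oner_neq0 _) mh); last first.
    by move=> z; rewrite lee_fin mulr_ge0// normal_pdf_ge0.
  rewrite -ge0_integralZr; last 4 first.
  - exact: measurableT.
  - apply: measurable_funeM; apply: (measurableT_comp mh).
    by apply: measurable_funD => //; exact: mulrl_measurable.
  - by move=> z _; rewrite normr1 mul1e lee_fin mulr_ge0// normal_pdf_ge0.
  - by rewrite lee_fin normal_pdf_ge0.
  apply: eq_integral => z _.
  rewrite normr1 mul1e -EFinM mul1r /f/= mulrA; congr (_ * _ * _)%:E.
  rewrite !indicE; congr (_ %:R); congr nat_of_bool.
  by rewrite mem_xsection; apply/idP/idP; rewrite !inE/= /g/= subrK.
rewrite fubini_tonelli//.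
rewrite (normal_prob_indic _ _ _ mA).
apply: eq_integral => z _.
transitivity (\int[mu]_y ((\1_A z * normal_pdf 0 c z)%:E *
    (normal_pdf (a * z / c ^+ 2) (s / c) y)%:E))%E.
  apply: eq_integral => y _.
  by rewrite /f/= (normal_pdf_complete_square _ _ c)// -EFinM mulrA.
rewrite ge0_integralZl ?integral_normal_pdf ?mule1//.
- by apply/measurable_EFinP; exact: measurable_normal_pdf.
- by move=> y _; rewrite lee_fin normal_pdf_ge0.
- by rewrite lee_fin mulr_ge0// normal_pdf_ge0.
Qed.
End normal_law.

(** * Independence of partial sums *)

Lemma measurable_fun_bigsum {R : realType} {d : measure_display}
    {T : measurableType d} {I : eqType} (r : seq I) (f : I -> T -> R) :
  (forall i, i \in r -> measurable_fun [set: T] (f i)) ->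
  measurable_fun [set: T] (fun w => \sum_(i <- r) f i w).
Proof.
elim: r => [|i r IH] mf.
  by under eq_fun do rewrite big_nil; exact: measurable_cst.
under eq_fun do rewrite big_cons.
apply: measurable_funD; first by apply: mf; rewrite mem_head.
by apply: IH => k kr; apply: mf; rewrite in_cons kr orbT.
Qed.

(** Dynkin's argument: the cylinders over the coordinates other than j are
    closed under intersection and independent of X j, hence so is the
    sigma-algebra that they generate, for which the sum is measurable. *)
Lemma mutually_independent_sum {R : realType} {d : measure_display}
    {T : measurableType d} (P : probability T R) {I : finType}
    (X : I -> T -> R) (a : I -> R) (r : seq I) (j : I) :
  (forall i, measurable_fun [set: T] (X i)) -> mutually_independent P X ->
  j \notin r ->
  forall A B : set R, measurable A -> measurable B ->
  P ((fun w => \sum_(i <- r) a i * X i w) @^-1` A `&` X j @^-1` B) =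
  (P ((fun w => (\sum_(i <- r) a i * X i w)%R) @^-1` A) * P (X j @^-1` B))%E.
Proof.
move=> mX indep jr A B mA mB.
have mXV i C : measurable C -> measurable (X i @^-1` C).
  by move=> mC; rewrite -[X in measurable X]setTI; exact: mX.
pose cyl (C : I -> set R) := \bigcap_(i in [set` [set~ j]%SET]) X i @^-1` C i.
pose G : set (set T) := [set cyl C | C in [set C | forall i, measurable (C i)]].
have mG : G `<=` measurable.
  move=> _ [C mC <-]; apply: fin_bigcap_measurable => [|i _].
    exact: finite_finset.
  exact: mXV.
have GT : G setT.
  exists (fun=> setT) => //; apply/seteqP; split => // w _ i _ //=.
have GI : setI_closed G.
  move=> _ _ [C1 mC1 <-] [C2 mC2 <-]; exists (fun i => C1 i `&` C2 i).
    by move=> i; exact: measurableI.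
  apply/seteqP; split => w.
    by move=> H; split => i /H [].
  by move=> [H1 H2] i ij; split; [exact: H1|exact: H2].
have mXB := mXV j B mB.
have fPB : P (X j @^-1` B) = (fine (P (X j @^-1` B)))%:E by rewrite fineK// fin_num_measure.
pose k : {nonneg R} := NngNum (fine_ge0 (measure_ge0 P (X j @^-1` B))).
(* Both sides are finite measures in E, which agree on the cylinders. *)
have PG E : <<s G >> E -> (mrestr P mXB E = mscale k P E)%E.
  apply: (g_sigma_algebra_measure_unique G mG (fun=> setT)) => //.
  - by rewrite bigcup_const.
  - move=> _ [C mC <-].
    change (P (cyl C `&` X j @^-1` B) =
      ((fine (P (X j @^-1` B)))%:E * P (cyl C))%E).
    (* The event on X j is the missing factor of a full cylinder. *)
    pose C' i := if i == j then B else C i.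
    have mC' i : measurable (C' i) by rewrite /C'; case: ifP.
    have -> : cyl C `&` X j @^-1` B =
        \bigcap_(i in [set` [set: I]%SET]) X i @^-1` C' i.
      apply/seteqP; split => w.
        move=> [H1 H2] i _ /=; rewrite /C'; have [->//|ij] := eqVneq i j.
        by apply: H1; rewrite /= !inE.
      move=> H; split => [i|].
        rewrite /= !inE => ij; have := H i; rewrite /= inE /C' (negbTE ij).
        by apply.
      by have := H j; rewrite /= inE /C' eqxx; apply.
    have -> : cyl C = \bigcap_(i in [set` [set~ j]%SET]) X i @^-1` C' i.
      apply: eq_bigcapr => i; rewrite /= !inE => ij.
      by rewrite /C' (negbTE ij).
    rewrite !indep// (bigD1 j) ?inE//= {1}/C' eqxx -fPB; congr (_ * _)%E.
    by apply: eq_bigl => i; rewrite !inE.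
  - by move=> _; rewrite /= /mrestr setTI ltey_eq fin_num_measure.
rewrite [RHS]muleC [in RHS]fPB; apply: PG.
suff : measurable_fun [set: g_sigma_algebraType G]
    (fun w => \sum_(i <- r) a i * X i w).
  by move=> /(_ measurableT A mA); rewrite setTI.
apply: measurable_fun_bigsum => i ir; apply: measurable_funM => //.
move=> _ D mD; rewrite setTI; apply: sub_sigma_algebra.
exists (fun k => if k == i then D else setT).
  by move=> k' /=; case: ifP.
have ij : i != j by apply: contraNneq jr => <-.
apply/seteqP; split => w.
  by move=> /(_ i); rewrite /= !inE eqxx; apply.
by move=> H k' _ /=; case: eqP => // ->.
Qed.

(** * Law of a projection of a Gaussian vector *)

(** Induction on the list of coordinates. The convolution step needs a partial
    sum with positive variance, so the first non-zero coefficient is treated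
    separately, by scaling. *)
Lemma normal_law_sum {R : realType} {d : measure_display}
    {T : measurableType d} (P : probability T R) {I : finType}
    (X : I -> T -> R) (a : I -> R) (r : seq I) :
  (forall i, measurable_fun [set: T] (X i)) -> mutually_independent P X ->
  (forall i, std_normal P (X i)) -> uniq r -> 0 < \sum_(i <- r) a i ^+ 2 ->
  forall A : set R, measurable A ->
  P ((fun w => \sum_(i <- r) a i * X i w) @^-1` A) =
  normal_prob 0 (Num.sqrt (\sum_(i <- r) a i ^+ 2)) A.
Proof.
move=> mX indep nX; elim: r => [|j r IH]; first by rewrite big_nil ltxx.
rewrite cons_uniq => /andP[jr ur]; rewrite big_cons.
have V0 : 0 <= \sum_(i <- r) a i ^+ 2 by apply: sumr_ge0 => i _; exact: sqr_ge0.
have [V0E|VN0] := eqVneq (\sum_(i <- r) a i ^+ 2) 0.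
  rewrite V0E addr0 => aj0 A mA.
  have aj : a j != 0 by rewrite -sqrf_eq0 gt_eqF.
  have -> : (fun w => \sum_(i <- j :: r) a i * X i w) = (fun w => a j * X j w).
    apply/funext => w; rewrite big_cons big_seq big1 ?addr0//.
    move=> i ir; have /allP/(_ i ir) : all (fun i => true ==> (a i ^+ 2 == 0)) r.
      by rewrite -psumr_eq0 ?V0E// => k _; exact: sqr_ge0.
    by rewrite /= sqrf_eq0 => /eqP ->; rewrite mul0r.
  rewrite sqrtr_sqr; exact: normal_law_scale.
have Vpos : 0 < \sum_(i <- r) a i ^+ 2 by rewrite lt0r VN0.
move=> Vj A mA.
have -> : (fun w => \sum_(i <- j :: r) a i * X i w) =
    (fun w => \sum_(i <- r) a i * X i w + a j * X j w).
  by apply/funext => w; rewrite big_cons addrC.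
apply: (normal_law_add P _ _ (Num.sqrt (\sum_(i <- r) a i ^+ 2))).
- by apply: measurable_fun_bigsum => i _; exact: measurable_funM.
- exact: mX.
- by rewrite sqrtr_gt0.
- by rewrite sqrtr_gt0.
- by rewrite !sqr_sqrtr ?ltW// addrC.
- exact: IH.
- exact: nX.
- exact: mutually_independent_sum.
- exact: mA.
Qed.

Lemma measurable_dot {R : realType} {p : nat} (a : p.-tuple R) :
  measurable_fun [set: p.-tuple R] (fun v => dot v a).
Proof.
apply: measurable_fun_bigsum => i _; apply: measurable_funM => //.
exact: measurable_tnth.
Qed.

Lemma normal_law_dot {R : realType} {d : measure_display}
    {T : measurableType d} (P : probability T R) {p : nat}
    (X : T -> p.-tuple R) (a : p.-tuple R) :
  measurable_fun [set: T] X -> std_normal_vector P X -> 0 < dot a a ->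
  forall A : set R, measurable A ->
  P ((fun w => dot (X w) a) @^-1` A) = normal_prob 0 (norm2 a) A.
Proof.
move=> mX [indep nX] a0 A mA.
have aE : dot a a = \sum_(i <- index_enum 'I_p) tnth a i ^+ 2 by [].
rewrite /norm2 aE.
have -> : (fun w => dot (X w) a) =
    (fun w => \sum_(i <- index_enum 'I_p) tnth a i * tnth (X w) i).
  by apply/funext => w; apply: eq_bigr => i _; rewrite mulrC.
apply: (normal_law_sum P _ (tnth a) _ _ indep nX (index_enum_uniq _)) => //.
by move=> i; exact: (measurableT_comp (measurable_tnth i) mX).
Qed.

(** * Estimates for one-dimensional normal laws *)

Section normal_bounds.
Context {R : realType}.
Notation mu := (@lebesgue_measure R).

Lemma normal_pdf_le_norm (s x y : R) : s != 0 -> `|x| <= `|y| ->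
  normal_pdf 0 s y <= normal_pdf 0 s x.
Proof.
move=> s0 xy; rewrite !normal_pdfE// ler_wpM2l ?normal_peak_ge0// ler_expR.
rewrite !subr0 !mulNr lerN2 ler_wpM2r ?invr_ge0 ?mulrn_wge0 ?sqr_ge0//.
by rewrite -(real_normK (num_real x)) -(real_normK (num_real y)) lerXn2r// nnegrE.
Qed.

Lemma normal_prob_itv_ge (m s a b k : R) : a <= b -> 0 <= k ->
  (forall x, a <= x <= b -> k <= normal_pdf m s x) ->
  ((k * (b - a))%:E <= normal_prob m s `[a, b])%E.
Proof.
move=> ab k0 kpdf.
apply: (@le_trans _ _ (\int[mu]_(x in `[a, b]) k%:E)%E).
  rewrite integral_cst//= lebesgue_measure_itv/= lte_fin.
  have [_|ba] := ltP a b; first by rewrite -EFinB -EFinM.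
  by rewrite mule0 lee_fin (@le_anti _ _ a b) ?ab// subrr mulr0.
apply: ge0_le_integral => //=.
- by apply/measurable_funTS/measurable_EFinP; exact: measurable_normal_pdf.
Qed.

Lemma normal_prob_centered_itv_ge (s : R) : 0 <= s <= 1 ->
  ((normal_pdf 0 1 1 * (2 * s))%:E <= normal_prob (0 : R) 1 `[(- s)%R, s])%E.
Proof.
move=> /andP[s0 s1]; have -> : 2 * s = s - - s by lra.
apply: normal_prob_itv_ge; [lra|exact: normal_pdf_ge0|move=> x xs].
apply: normal_pdf_le_norm; first exact: oner_neq0.
by rewrite normr1 ler_norml; lra.
Qed.

Lemma normal_prob_centered_itv_le (s u : R) : 1 <= s -> 0 <= u ->
  (normal_prob (0 : R) s `[(- u)%R, u] <= (2 * u)%:E)%E.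
Proof.
move=> s1 u0; have s0 : s != 0 by rewrite gt_eqF// (lt_le_trans ltr01).
apply: (@le_trans _ _ (\int[mu]_(x in `[(- u)%R, u]) 1%:E)%E); last first.
  rewrite integral_cst//= mul1e lebesgue_measure_itv/= lte_fin.
  case: ifPn => _; last by rewrite lee_fin mulr_ge0.
  by rewrite -EFinB lee_fin; lra.
apply: ge0_le_integral => //=.
- by move=> x _; rewrite lee_fin normal_pdf_ge0.
- by apply/measurable_funTS/measurable_EFinP; exact: measurable_normal_pdf.
- move=> x _; rewrite lee_fin (le_trans (normal_pdf_ub _ _ s0))//.
  have peak1 : 1 <= Num.sqrt (s ^+ 2 * pi *+ 2).
    rewrite -[leLHS]sqrtr1 ler_wsqrtr// -mulr_natr.
    have s2 : 1 <= s ^+ 2 by rewrite exprn_ege1.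
    have pi2 := @pi_ge2 R.
    nra.
  by rewrite /normal_peak invf_le1// (lt_le_trans ltr01).
Qed.

(** For |x| >= m the density is at most 2 exp(- 3 m^2 / 8) times the density of
    N(0, 4), which has total mass 1; exp u >= u then gives a bound of order
    1/m^2. *)
Lemma normal_prob_tail_le (m : R) : 0 < m ->
  (normal_prob (0 : R) 1 [set x | (m <= `|x|)%R] <= (6 / m ^+ 2)%:E)%E.
Proof.
move=> m0; pose k : R := 6 / m ^+ 2.
have k0 : 0 <= k by rewrite divr_ge0// sqr_ge0.
have mA : measurable [set x : R | m <= `|x|].
  rewrite (_ : mkset _ = [set: R] `&` (@Num.norm R R) @^-1` `[m, +oo[%classic).
    exact: normr_measurable.
  by apply/seteqP; split => x /=; rewrite in_itv/= andbT//; case.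
apply: (@le_trans _ _ (k%:E * normal_prob (0 : R) 2 [set x | (m <= `|x|)%R])%E); last first.
  rewrite -[leRHS]mule1; apply: lee_wpmul2l; first by rewrite lee_fin.
  exact: probability_le1.
rewrite /normal_prob -ge0_integralZl//; last 2 first.
- by apply/measurable_funTS/measurable_EFinP; exact: measurable_normal_pdf.
- by move=> x _; rewrite lee_fin normal_pdf_ge0.
apply: ge0_le_integral => //=.
- by move=> x _; rewrite lee_fin normal_pdf_ge0.
- by apply/measurable_funTS/measurable_EFinP; exact: measurable_normal_pdf.
- apply/measurable_funTS/measurable_EFinP; apply: measurable_funM => //.
  exact: measurable_normal_pdf.
- move=> x mx; rewrite -EFinM lee_fin !normal_pdfE// /normal_fun.
  have -> : normal_peak (1 : R) = 2 * normal_peak 2.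
    rewrite /normal_peak -[in RHS]mulrnAr sqrtrM ?sqr_ge0// sqrtr_sqr ger0_norm//.
    by rewrite invfM mulrA divff// mul1r expr1n mul1r.
  rewrite mulrAC [leRHS]mulrA [leRHS]mulrAC ler_wpM2r ?normal_peak_ge0//.
  (* 1/2 = 3/8 + 1/8, and 1/8 is the exponent of N(0, 4). *)
  have -> : - (x - 0) ^+ 2 / (1 ^+ 2 *+ 2) =
      - (3 / 8 * x ^+ 2) + - (x - 0) ^+ 2 / (2 ^+ 2 *+ 2) :> R.
    by rewrite -!(mulr_natr (_ ^+ 2)); field.
  rewrite expRD mulrA ler_wpM2r ?expR_ge0//.
  have x2 : m ^+ 2 <= x ^+ 2.
    by rewrite -(real_normK (num_real x)) lerXn2r// nnegrE ltW.
  have m2 : 0 < m ^+ 2 by rewrite exprn_gt0.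
  have u0 : 0 < 3 / 8 * x ^+ 2 by lra.
  rewrite expRN.
  apply: (@le_trans _ _ (2 * (3 / 8 * m ^+ 2)^-1)).
    rewrite ler_wpM2l// lef_pV2 ?posrE ?expR_gt0//; last lra.
    have := expR_ge1Dx (3 / 8 * x ^+ 2); lra.
  have -> : 2 * (3 / 8 * m ^+ 2)^-1 = (16 / 3) / m ^+ 2 by field; rewrite gt_eqF.
  by rewrite /k ler_wpM2r ?invr_ge0 ?sqr_ge0//; lra.
Qed.

Lemma normal_prob_le_sub (A B : set R) : measurable A -> measurable B ->
  A `<=` B -> (normal_prob (0 : R) 1 A <= normal_prob (0 : R) 1 B)%E.
Proof.
move=> mA mB.
by apply: (@le_measure _ R (measurableTypeR R) (normal_prob 0 1)); rewrite inE.
Qed.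

Lemma normal_prob_ge2 : ((normal_pdf 0 1 3)%:E <= normal_prob (0 : R) 1 `[2%R, +oo[)%E.
Proof.
apply: (@le_trans _ _ (normal_prob (0 : R) 1 `[2%R, 3%R])).
  have -> : normal_pdf 0 1 3 = normal_pdf 0 1 3 * (3 - 2) :> R by lra.
  apply: normal_prob_itv_ge; [lra|exact: normal_pdf_ge0|move=> x xs].
  apply: normal_pdf_le_norm; first exact: oner_neq0.
  by rewrite [leRHS]ger0_norm// ler_norml; lra.
by apply: normal_prob_le_sub => // x /=; rewrite !in_itv/=; lra.
Qed.

Lemma normal_prob_leN2 : ((normal_pdf 0 1 3)%:E <= normal_prob (0 : R) 1 `]-oo, (-2)%R])%E.
Proof.
apply: (@le_trans _ _ (normal_prob (0 : R) 1 `[(-3)%R, (-2)%R])).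
  have -> : normal_pdf 0 1 3 = normal_pdf 0 1 3 * (-2 - -3) :> R by lra.
  apply: normal_prob_itv_ge; [lra|exact: normal_pdf_ge0|move=> x xs].
  apply: normal_pdf_le_norm; first exact: oner_neq0.
  by rewrite [leRHS]ger0_norm// ler_norml; lra.
by apply: normal_prob_le_sub => // x /=; rewrite !in_itv/=; lra.
Qed.
End normal_bounds.

(** * Slabs and thin cones *)

Section measurable_sets.
Context {R : realType} {d : measure_display} {T : measurableType d}.
Implicit Types f g : T -> R.

Lemma measurable_set_le f g : measurable_fun [set: T] f ->
  measurable_fun [set: T] g -> measurable [set w | f w <= g w].
Proof.
move=> mf mg; rewrite (_ : mkset _ = [set: T] `&` (fun w => f w <= g w) @^-1` [set true]).
  by apply: measurable_fun_ler.
by rewrite setTI.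

Qed.

Lemma measurable_set_lt f g : measurable_fun [set: T] f ->
  measurable_fun [set: T] g -> measurable [set w | f w < g w].
Proof.
move=> mf mg; rewrite (_ : mkset _ = [set: T] `&` (fun w => f w < g w) @^-1` [set true]).
  by apply: measurable_fun_ltr.
by rewrite setTI.

Qed.

End measurable_sets.

Definition l1norm {R : realType} {p : nat} (v : p.-tuple R) : R :=
  \sum_(j < p) `|tnth v j|.

Lemma l1norm_ge0 {R : realType} {p : nat} (v : p.-tuple R) : 0 <= l1norm v.
Proof. by apply: sumr_ge0 => j _; exact: normr_ge0. Qed.

Lemma measurable_l1norm {R : realType} {p : nat} :
  measurable_fun [set: p.-tuple R] (@l1norm R p).
Proof.
apply: measurable_fun_bigsum => j _.
exact: (measurableT_comp (@normr_measurable R setT) (measurable_tnth j)).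
Qed.

Lemma dot_dist_le {R : realType} {p : nat} (v g h : p.-tuple R) (eta : R) :
  (forall j, `|tnth g j - tnth h j| <= eta) ->
  `|dot v g - dot v h| <= eta * l1norm v.
Proof.
move=> gh; rewrite /dot -sumrB mulr_sumr (le_trans (ler_norm_sum _ _ _))//.
apply: ler_sum => j _; rewrite -mulrBr normrM mulrC ler_wpM2r//.
Qed.

Lemma probability_bigsetU_le {R : realType} {d : measure_display}
    {T : measurableType d} (P : probability T R) {I : Type} (r : seq I)
    (F : I -> set T) (k : R) :
  (forall i, measurable (F i)) -> (forall i, P (F i) <= k%:E)%E ->
  (P (\big[setU/set0]_(i <- r) F i) <= ((size r)%:R * k)%:E)%E.
Proof.
move=> mF Fk; elim: r => [|i r IH].
  by rewrite big_nil measure0 mul0r.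
rewrite big_cons /= -natr1 mulrDl mul1r addrC EFinD.
apply: (le_trans (measureU2 _ _ _)) => //.
  by apply: bigsetU_measurable.
exact: leeD (Fk i) IH.
Qed.

Section gaussian_vector.
Context {R : realType} {d : measure_display} {T : measurableType d}
  (P : probability T R) {p : nat} (X : T -> p.-tuple R).
Hypothesis mX : measurable_fun [set: T] X.
Hypothesis nX : std_normal_vector P X.

Lemma gaussian_slab_ge (beta : p.-tuple R) (s : R) : norm2 beta = 1 ->
  0 <= s <= 1 ->
  ((normal_pdf 0 1 1 * (2 * s))%:E <= P [set w | (`|dot (X w) beta| <= s)%R])%E.
Proof.
move=> beta1 s01.
have -> : [set w | `|dot (X w) beta| <= s] =
    (fun w => dot (X w) beta) @^-1` `[- s, s]%classic.
  by apply/seteqP; split => w /=; rewrite in_itv/= ler_norml.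
rewrite normal_law_dot// ?beta1; first exact: normal_prob_centered_itv_ge.
rewrite lt_neqAle sumr_ge0 ?andbT => [|j _]; last by rewrite -expr2 sqr_ge0.
apply: contra_eq_neq beta1 => beta0.
by rewrite /norm2 -beta0 sqrtr0 eq_sym oner_neq0.
Qed.

(** Outside the events |x_j| >= m one has |x|_1 <= p m, so the cone is contained
    in a slab of half-width eta p m. *)
Lemma gaussian_thin_cone_le (g : p.-tuple R) (eta m : R) : 1 <= dot g g ->
  0 <= eta -> 0 < m ->
  (P [set w | (`|dot (X w) g| < eta * l1norm (X w))%R] <=
   (2 * (eta * (p%:R * m)) + p%:R * (6 / m ^+ 2))%:E)%E.
Proof.
move=> g1 eta0 m0.
have mdotX := measurableT_comp (measurable_dot g) mX.
have mXj j : measurable_fun [set: T] (fun w => tnth (X w) j).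
  exact: (measurableT_comp (measurable_tnth j) mX).
pose S := [set w | `|dot (X w) g| <= eta * (p%:R * m)].
pose F (j : 'I_p) := [set w | m <= `|tnth (X w) j|].
have mS : measurable S.
  by apply: measurable_set_le => //; exact: (measurableT_comp (@normr_measurable R setT) mdotX).
have mF j : measurable (F j).
  by apply: measurable_set_le => //; exact: (measurableT_comp (@normr_measurable R setT) (mXj j)).
have mUF : measurable (\big[setU/set0]_(j <- enum 'I_p) F j).
  exact: bigsetU_measurable.
apply: (@le_trans _ _ (P (S `|` \big[setU/set0]_(j <- enum 'I_p) F j))).
  apply: le_measure; rewrite ?inE.
  - apply: measurable_set_lt; first exact: (measurableT_comp (@normr_measurable R setT) mdotX).
    by apply: measurable_funM => //; exact: (measurableT_comp measurable_l1norm mX).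
  - exact: measurableU.
  - move=> w /= wlt; rewrite -bigcup_seq.
    have [|nF] := pselect (exists j, F j w).
      by move=> [j Fj]; right; exists j => //=; rewrite mem_enum.
    left; apply: (le_trans (ltW wlt)); rewrite ler_wpM2l//.
    rewrite mulr_natl -[X in _ *+ X]card_ord -sumr_const; apply: ler_sum => j _.
    by rewrite leNgt; apply/negP => mj; apply: nF; exists j; exact: ltW.
apply: (le_trans (measureU2 _ _ _)) => //; rewrite EFinD leeD//.
  have -> : S = (fun w => dot (X w) g) @^-1`
      `[- (eta * (p%:R * m)), eta * (p%:R * m)]%classic.
    by apply/seteqP; split => w; rewrite /S/= in_itv/= ler_norml.
  rewrite [leLHS](normal_law_dot P X g mX nX (lt_le_trans ltr01 g1)) //.
  apply: normal_prob_centered_itv_le; last by rewrite !mulr_ge0// ltW.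
  by rewrite /norm2 -[leLHS]sqrtr1 ler_wsqrtr.
rewrite -[X in X%:R](size_enum_ord p); apply: probability_bigsetU_le => // j.
have -> : F j = (fun w => tnth (X w) j) @^-1` [set x | m <= `|x|] by [].
case: nX => _ nXj; rewrite [leLHS]nXj; first exact: normal_prob_tail_le.
by apply: measurable_set_le => //; exact: measurableT_comp.
Qed.

End gaussian_vector.

(** * Probability that an observation contradicts a direction *)

(** The observation contradicts g by a margin large enough to contradict also
    every direction within sup-distance eta of g. The factor |vy.2|, which is 1
    almost surely, makes this implication hold for every real label. *)
Definition margin_violated {R : realType} {p : nat} (g : p.-tuple R) (eta : R) :
    set (p.-tuple R * R) :=
  [set vy | vy.2 * dot vy.1 g <= - (eta * (`|vy.2| * l1norm vy.1))].

Lemma measurable_margin_violated {R : realType} {p : nat} (g : p.-tuple R) (eta : R) :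
  measurable (margin_violated g eta).
Proof.
apply: measurable_set_le.
  apply: measurable_funM; first exact: measurable_snd.
  exact: (measurableT_comp (measurable_dot g) measurable_fst).
apply: measurable_funN; apply: measurable_funM => //; apply: measurable_funM.
  exact: (measurableT_comp (@normr_measurable R setT) measurable_snd).
exact: (measurableT_comp measurable_l1norm measurable_fst).
Qed.

Lemma measurable_label {R : realType} {d : measure_display}
    {T : measurableType d} {p : nat} (sigma : R) (beta : p.-tuple R)
    (x : T -> p.-tuple R) (eps : T -> R) :
  measurable_fun [set: T] x -> measurable_fun [set: T] eps ->
  measurable_fun [set: T] (fun w => label sigma beta (x w) (eps w)).
Proof.
move=> mx meps.
have mu : measurable_fun [set: T] (fun w => dot (x w) beta + sigma * eps w).
  apply: measurable_funD; first exact: (measurableT_comp (measurable_dot beta) mx).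
  exact: measurable_funM.
have sgE (u : R) : Num.sg u = \1_`]0, +oo[ u - \1_`]-oo, 0[ u.
  rewrite !indicE; have [u0|u0|->] := ltgtP u 0.
  - rewrite ltr0_sg// [in X in X - _]memNset/= ?mem_set/= ?in_itv/= ?andbT//.
      by rewrite sub0r.
    by rewrite ltNge ltW.
  - rewrite gtr0_sg// mem_set/= ?memNset/= ?in_itv/= ?andbT ?subr0//.
    by rewrite ltNge ltW.
  - by rewrite sgr0 !memNset/= ?in_itv/= ?ltxx// subrr.
rewrite /label; under eq_fun do rewrite sgE.
by apply: measurable_funB; apply: (measurableT_comp _ mu); exact: measurable_indic.
Qed.

Section violation.
Context {R : realType} {d : measure_display} {T : measurableType d}
  (P : probability T R) {p : nat} (x : {RV P >-> p.-tuple R})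
  (eps : {RV P >-> R}).
Hypothesis nx : std_normal_vector P x.
Hypothesis neps : std_normal P eps.
Hypothesis x_eps : independent2 x eps.

(** With A the slab |x.beta| <= sigma and B the thin cone around the hyperplane
    orthogonal to g, the event x in A but not in B is split by the sign of x.g.
    On either half, a noise of absolute value at least 2 and of sign opposite to
    x.g imposes a label opposite to x.g; the noise is independent of x, so this
    costs at most the factor [normal_pdf 0 1 3]. *)
Lemma margin_violated_ge (sigma eta m : R) (beta g : p.-tuple R) :
  0 < sigma <= 1 -> norm2 beta = 1 -> 1 <= dot g g -> 0 <= eta -> 0 < m ->
  ((normal_pdf 0 1 3 * (normal_pdf 0 1 1 * (2 * sigma)
      - (2 * (eta * (p%:R * m)) + p%:R * (6 / m ^+ 2))))%:E
   <= P ((fun w => (x w, label sigma beta (x w) (eps w))) @^-1`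
         margin_violated g eta))%E.
Proof.
move=> /andP[s0 s1] beta1 g1 eta0 m0.
have mx : measurable_fun [set: T] x by [].
have meps : measurable_fun [set: T] eps by [].
pose phi : R := normal_pdf 0 1 3.
have phi0 : 0 <= phi by exact: normal_pdf_ge0.
set kA := normal_pdf 0 1 1 * (2 * sigma).
set kB := 2 * (eta * (p%:R * m)) + p%:R * (6 / m ^+ 2).
pose A : set (p.-tuple R) := [set v | `|dot v beta| <= sigma].
pose B : set (p.-tuple R) := [set v | `|dot v g| < eta * l1norm v].
pose U : set (p.-tuple R) := [set v | 0 < dot v g].
have mnd (h : p.-tuple R) : measurable_fun [set: p.-tuple R] (fun v => `|dot v h|).
  exact: (measurableT_comp (@normr_measurable R setT) (measurable_dot h)).
have mA : measurable A by exact: measurable_set_le.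
have mB : measurable B.
  apply: measurable_set_lt; first exact: mnd.
  by apply: measurable_funM => //; exact: measurable_l1norm.
have mU : measurable U by apply: measurable_set_lt => //; exact: measurable_dot.
have mpre (C : set (p.-tuple R)) : measurable C -> measurable (x @^-1` C).
  by move=> mC; rewrite -[X in measurable X]setTI; exact: mx.
have mepre (C : set R) : measurable C -> measurable (eps @^-1` C).
  by move=> mC; rewrite -[X in measurable X]setTI; exact: meps.
have PAB : ((kA - kB)%:E <= P (x @^-1` (A `\` B)))%E.
  rewrite EFinB leeBlDr//.
  apply: (le_trans (gaussian_slab_ge P x mx nx beta _ beta1 _)); first by rewrite ltW.
  apply: (@le_trans _ _ (P (x @^-1` (A `\` B)) + P (x @^-1` B))%E).
    apply: (@le_trans _ _ (P (x @^-1` (A `\` B) `|` x @^-1` B))).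
      apply: le_measure; rewrite ?inE.
      - exact: (mpre A).
      - by apply: measurableU; apply: mpre => //; exact: measurableD.
      - by move=> w Aw; have [Bw|nBw] := pselect (B (x w)); [right|left; split].
    apply: measureU2; apply: mpre => //; exact: measurableD.
  by apply: leeD2l; exact: gaussian_thin_cone_le.
pose Dp := (A `\` B) `&` U; pose Dm := (A `\` B) `\` U.
have mDp : measurable Dp by apply: measurableI => //; exact: measurableD.
have mDm : measurable Dm by apply: measurableD => //; exact: measurableD.
pose Ep : set R := `]-oo, (-2)]%classic; pose Em : set R := `[2, +oo[%classic.
have mEp : measurable Ep by exact: measurable_itv.
have mEm : measurable Em by exact: measurable_itv.
have good : x @^-1` Dp `&` eps @^-1` Ep `|` x @^-1` Dm `&` eps @^-1` Em `<=`
    (fun w => (x w, label sigma beta (x w) (eps w))) @^-1` margin_violated g eta.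
  move=> w [[[[Aw nBw] Uw] Ew]|[[[Aw nBw] nUw] Ew]];
    move: Aw nBw Ew; rewrite /A /B /Ep /Em /margin_violated /= in_itv/= ?andbT;
    rewrite ler_norml => /andP[A1 A2] /negP; rewrite -leNgt => Bw Ew.
  - have -> : label sigma beta (x w) (eps w) = -1.
      by rewrite /label ltr0_sg//; nra.
    by rewrite normrN1 mul1r mulN1r lerN2 -[leRHS]gtr0_norm.
  - have -> : label sigma beta (x w) (eps w) = 1.
      by rewrite /label gtr0_sg//; nra.
    move: nUw; rewrite /U /= => /negP; rewrite -leNgt => nUw.
    by rewrite normr1 !mul1r lerNr -ler0_norm.
apply: (@le_trans _ _ (P (x @^-1` Dp `&` eps @^-1` Ep `|`
    x @^-1` Dm `&` eps @^-1` Em))); last first.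
  apply: le_measure; rewrite ?inE//.
    by apply: measurableU; apply: measurableI; [exact: mpre|exact: mepre|exact: mpre|exact: mepre].
  rewrite -[X in measurable X]setTI.
  have mxl : measurable_fun [set: T]
      (fun w => (x w, label sigma beta (x w) (eps w))).
    by apply: measurable_fun_pair => //; exact: measurable_label.
  by apply: mxl => //; exact: measurable_margin_violated.
rewrite measureU; last 3 first.
- by apply: measurableI; [exact: mpre|exact: mepre].
- by apply: measurableI; [exact: mpre|exact: mepre].
- by apply/seteqP; split => // w [[[_ Uw] _] [[_ nUw] _]].
apply: (@le_trans _ _ (P (x @^-1` Dp) * phi%:E + P (x @^-1` Dm) * phi%:E)%E); last first.
  apply: leeD.
  - rewrite [leRHS](x_eps _ _ mDp mEp) (neps _ mEp).
    by apply: lee_wpmul2l => //; exact: normal_prob_leN2.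
  - rewrite [leRHS](x_eps _ _ mDm mEm) (neps _ mEm).
    by apply: lee_wpmul2l => //; exact: normal_prob_ge2.
rewrite -ge0_muleDl// -measureU; last 3 first.
- exact: mpre.
- exact: mpre.
- by apply/seteqP; split => // w [[_ Uw] [_ nUw]].
have -> : x @^-1` Dp `|` x @^-1` Dm = x @^-1` (A `\` B).
  by rewrite -preimage_setU setUIDK.
by rewrite EFinM muleC lee_wpmul2r.
Qed.
End violation.

(** * Rounding a separator *)

Lemma dot_scale {R : realType} {p : nat} (v g : p.-tuple R) (c : R) :
  dot v [tuple c * tnth g j | j < p] = c * dot v g.
Proof.
rewrite /dot mulr_sumr; apply: eq_bigr => j _.
by rewrite tnth_mktuple mulrCA.
Qed.

(** Both roundings of a separator g, to the grid and to integers, produce a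
    direction h near a positive multiple of g. *)
Lemma margin_approx {R : realType} {p : nat} (v g h : p.-tuple R) (y c eta : R) :
  (forall j, `|tnth h j - c * tnth g j| <= eta) ->
  c * (y * dot v g) - eta * (`|y| * l1norm v) <= y * dot v h.
Proof.
move=> hg; have dvh : `|dot v h - c * dot v g| <= eta * l1norm v.
  by rewrite -dot_scale; apply: dot_dist_le => j; rewrite tnth_mktuple.
have : `|y * (dot v h - c * dot v g)| <= eta * (`|y| * l1norm v).
  by rewrite normrM mulrCA ler_wpM2l.
by rewrite ler_norml => /andP[+ _]; lra.
Qed.

(** Separation is an open condition on the direction and invariant under
    scaling, so it is enough to consider the countably many integer directions. *)
Lemma measurable_linearly_separable {R : realType} {d : measure_display}
    {T : measurableType d} {n p : nat} (z : 'I_n -> T -> p.-tuple R * R) :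
  (forall i, measurable_fun [set: T] (z i)) ->
  measurable [set w | linearly_separable (fun i => z i w)].
Proof.
move=> mz.
pose vec (k : p.-tuple int) : p.-tuple R := [tuple (tnth k j)%:~R | j < p].
rewrite (_ : mkset _ = \bigcup_(k : p.-tuple int) \bigcap_(i in [set: 'I_n])
    [set w | 0 < (z i w).2 * dot (z i w).1 (vec k)]).
  apply: countable_bigcupT_measurable => [|k]; first exact: countableP.
  apply: fin_bigcap_measurable => [|i _]; first exact: finite_finset.
  apply: measurable_set_lt => //; apply: measurable_funM.
    exact: (measurableT_comp measurable_snd (mz i)).
  exact: (measurableT_comp (measurable_dot _) (measurableT_comp measurable_fst (mz i))).
apply/seteqP; split => w /=; last first.
  by move=> [k _ H]; exists (vec k) => i; exact: H.
move=> [g sep].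
pose marg i := (z i w).2 * dot (z i w).1 g.
pose slack i := `|(z i w).2| * l1norm (z i w).1.
(* After scaling by N, every margin exceeds the loss caused by rounding. *)
pose N := \max_(i < n) (Num.trunc (slack i / marg i)).+1.
pose k : p.-tuple int := [tuple Num.floor (N%:R * tnth g j) | j < p].
exists k => // i _ /=.
have mi : 0 < marg i := sep i.
have si : 0 <= slack i by rewrite mulr_ge0// l1norm_ge0.
have NS : slack i < N%:R * marg i.
  rewrite -ltr_pdivrMr//.
  have /andP[_] := truncn_itv (divr_ge0 si (ltW mi)).
  move=> /lt_le_trans; apply; rewrite ler_nat.
  exact: (@leq_bigmax _ (fun i => (Num.trunc (slack i / marg i)).+1) i).
apply: (@lt_le_trans _ _ (N%:R * marg i - 1 * slack i)); first by lra.
apply: margin_approx => j; rewrite /vec !tnth_mktuple.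
have := floor_itv (N%:R * tnth g j); rewrite intrD => /andP[].
by rewrite ler_norml; lra.
Qed.

(** The points of [-1, 1]^p with coordinates in (1/N)Z, indexed by a finite type
    for the union bound. *)
Definition grid {R : realType} {p : nat} (N : nat)
    (f : {ffun 'I_p -> 'I_(2 * N).+1}) : p.-tuple R :=
  [tuple (f j)%:R / N%:R - 1 | j < p].

(** Scaling g to sup norm 1 and rounding down keeps exactly a coordinate equal to
    1 or -1, whence the lower bound on the norm of the grid point. *)
Lemma grid_approx {R : realType} {p N : nat} (g : p.-tuple R) (j1 : 'I_p) :
  (0 < N)%N -> tnth g j1 != 0 ->
  exists f : {ffun 'I_p -> 'I_(2 * N).+1}, exists2 c : R, 0 < c &
    (forall j, `|tnth (grid N f) j - c * tnth g j| <= N%:R^-1) /\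
    1 <= dot (grid N f : p.-tuple R) (grid N f).
Proof.
move=> N0 gj1.
have NR0 : (0 : R) < N%:R by rewrite ltr0n.
pose j0 := [arg max_(j > j1) `|tnth g j|]%O.
have j0max j : `|tnth g j| <= `|tnth g j0|.
  by rewrite /j0; case: arg_maxP => // i _; apply.
have M0 : 0 < `|tnth g j0| by rewrite (lt_le_trans _ (j0max j1))// normr_gt0.
pose c := `|tnth g j0|^-1.
have c0 : 0 < c by rewrite invr_gt0.
have cg j : -1 <= c * tnth g j <= 1.
  by rewrite -ler_norml normrM gtr0_norm// mulrC ler_pdivrMr// mul1r.
pose u j := (c * tnth g j + 1) * N%:R.
have u0 j : 0 <= u j by have := cg j; rewrite /u; nra.
have tu j : (Num.trunc (u j) < (2 * N).+1)%N.
  rewrite ltnS -(@ler_nat R) (@le_trans _ _ (u j))//; first by rewrite truncn_le.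
  by rewrite natrM; have := cg j; rewrite /u; nra.
exists [ffun j => Ordinal (tu j)], c => //.
have gridE j : tnth (grid N [ffun j => Ordinal (tu j)]) j =
    (Num.trunc (u j))%:R / N%:R - 1 :> R by rewrite tnth_mktuple ffunE.
split.
  move=> j; rewrite gridE.
  have -> : (Num.trunc (u j))%:R / N%:R - 1 - c * tnth g j =
      ((Num.trunc (u j))%:R - u j) / N%:R.
    by rewrite /u; field; rewrite gt_eqF.
  rewrite normrM (gtr0_norm (_ : 0 < N%:R^-1)) ?invr_gt0//.
  rewrite ler_piMl ?invr_ge0 ?ler0n//.
  have /andP[] := truncn_itv (u0 j); rewrite -natr1 => t1 t2.
  by rewrite ler_norml; lra.
have sq1 : tnth (grid N [ffun j => Ordinal (tu j)]) j0 ^+ 2 = 1 :> R.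
  have : `|c * tnth g j0| = 1.
    by rewrite normrM gtr0_norm// mulVf// gt_eqF.
  rewrite gridE /u => /eqP; rewrite eqr_norml => /andP[/orP[/eqP->|/eqP->] _].
    rewrite (_ : (1 + 1) * N%:R = (2 * N)%:R); last by rewrite natrM.
    rewrite natrK natrM mulfK ?gt_eqF//.
    by rewrite -[2%:R]/(1 + 1) addrK expr1n.
  by rewrite addNr mul0r truncn0 mul0r sub0r sqrrN expr1n.
rewrite /dot (bigD1 j0)//= -expr2 sq1 lerDl sumr_ge0// => j _.
by rewrite -expr2 sqr_ge0.
Qed.

Lemma prode_le_exp {R : realType} {I : finType} (a : I -> \bar R) (b : R) :
  (forall i, 0 <= a i <= b%:E)%E ->
  (\prod_(i in [set: I]%SET) a i <= (b ^+ #|I|)%:E)%E.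
Proof.
move=> ab; rewrite -cardsT -prodr_const.
suff /andP[] : (0 <= \prod_(i in [set: I]%SET) a i <=
    (\prod_(i in [set: I]%SET) b)%:E)%E by [].
apply: (big_ind2 (fun (x : \bar R) (y : R) => 0 <= x <= y%:E)%E).
- by rewrite lexx lee01.
- move=> x1 y1 x2 y2 /andP[x10 xy1] /andP[x20 xy2].
  by rewrite mule_ge0//= EFinM lee_pmul.
- by move=> i _; exact: ab.
Qed.

(** * The union bound *)

(** A grid point near a scaled separator is contradicted by no observation with
    the rounding error 1/N as margin. *)
Lemma separable_grid {R : realType} {n p : nat} (N : nat)
    (z : 'I_n -> p.-tuple R * R) :
  (0 < n)%N -> (0 < N)%N -> linearly_separable z ->
  exists f : {ffun 'I_p -> 'I_(2 * N).+1},
    1 <= dot (grid N f : p.-tuple R) (grid N f) /\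
    forall i, ~ margin_violated (grid N f) N%:R^-1 (z i).
Proof.
move=> n0 N0 [g sep].
have [j1 gj1] : exists j1, tnth g j1 != 0.
  apply/existsP; rewrite -negb_forall; apply/negP => /forallP g0.
  have := sep (Ordinal n0); rewrite /dot big1 ?mulr0 ?ltxx// => j _.
  by rewrite (eqP (g0 j)) mulr0.
have [f [c c0 [fg f1]]] := grid_approx g j1 N0 gj1.
exists f; split => // i; rewrite /margin_violated /=; apply/negP; rewrite -ltNge.
apply: lt_le_trans (margin_approx _ _ _ _ _ _ fg).
by rewrite ltrDr mulr_gt0.
Qed.

Lemma grid_card_le {R : realType} (n p : nat) : (1 < n)%N ->
  (#|{ffun 'I_p -> 'I_(2 * n ^ 2).+1}|%:R : R) <= expR (4 * (p%:R * ln n%:R)).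
Proof.
move=> n1; rewrite card_ffun !card_ord.
have n4 : ((2 * n ^ 2).+1 <= n ^ 4)%N by nia.
have -> : 4 * (p%:R * ln n%:R) = (4 * p)%:R * ln n%:R :> R by rewrite natrM mulrA.
rewrite expRM_natl lnK ?posrE ?ltr0n 1?ltnW// -natrX ler_nat expnM.
by case: p => [|p]; rewrite ?expn0// leq_exp2r.
Qed.

Lemma half_le_ln {R : realType} (n : nat) : (1 < n)%N -> 2^-1 <= ln (n%:R : R).
Proof.
move=> n1; apply: (@le_trans _ _ (ln (2 : R))); last first.
  by rewrite ler_ln ?posrE ?ltr0n ?ler_nat// ltnW.
have := @le_ln1Dx R (- 2^-1).
have -> : 1 + - 2^-1 = 2^-1 :> R by lra.
rewrite lnV ?posrE// => /(_ _); lra.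
Qed.

Theorem proposition2p3p1 (R : realType) :
  exists c : R, 0 < c /\
  forall (n p : nat) (sigma t : R) (beta : p.-tuple R),
    (0 < p)%N -> (p < n)%N -> 0 < sigma -> norm2 beta = 1 -> 0 < t ->
  forall (d0 : measure_display) (Omega0 : measurableType d0)
    (P0 : probability Omega0 R)
    (x : {RV P0 >-> p.-tuple R}) (eps : {RV P0 >-> R}),
    std_normal_vector P0 x -> std_normal P0 eps -> independent2 x eps ->
  forall (d : measure_display) (Omega : measurableType d)
    (P : probability Omega R)
    (data : 'I_n -> {RV P >-> (p.-tuple R * R)%type}),
    iid_copies P0 P (fun w => (x w, label sigma beta (x w) (eps w)))
      (fun i => data i : Omega -> p.-tuple R * R) ->
  (p%:R * ln n%:R + t) / n%:R <= c * sigma ->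
  sigma <= 1 / Num.sqrt 6 ->
  (P [set w | linearly_separable (fun i => data i w)]
     <= (4 * expR (- t))%:E)%E.
Proof.
pose phi1 : R := normal_pdf 0 1 1; pose phi3 : R := normal_pdf 0 1 3.
have phi_gt0 (u : R) : 0 < normal_pdf 0 1 u.
  by rewrite normal_pdfE ?oner_neq0// mulr_gt0 ?normal_peak_gt0 ?oner_neq0// expR_gt0.
have phi1_gt0 : 0 < phi1 by exact: phi_gt0.
have phi3_gt0 : 0 < phi3 by exact: phi_gt0.
have phi3_le1 : phi3 <= 1.
  rewrite -lee_fin; apply: (le_trans (@normal_prob_ge2 R)).
  exact: probability_le1.
(* c is chosen so that 16 c sigma = phi3 * (phi1 * sigma) is the lower bound
   left for one direction once the cone has taken half of the slab. *)
exists (phi1 * phi3 / 16); split; first by rewrite divr_gt0 ?mulr_gt0.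
move=> n p sigma t beta p0 pn sigma0 beta1 t0 d0 Omega0 P0 x eps nx neps x_eps.
move=> d Omega P data [data_indep data_law] noise sigma_small.
have n1 : (1 < n)%N by exact: leq_ltn_trans p0 pn.
have n0 : (0 < n)%N by exact: ltnW.
have nR0 : (0 : R) < n%:R by rewrite ltr0n.
have sigma1 : sigma <= 1.
  apply: (le_trans sigma_small); rewrite div1r invf_le1.
    by rewrite -[leLHS]sqrtr1 ler_wsqrtr// ler1n.
  by rewrite sqrtr_gt0.
set c := phi1 * phi3 / 16 in noise *.
have noise' : p%:R * ln n%:R + t <= c * sigma * n%:R.
  by rewrite -ler_pdivrMr.
have ln_n := @half_le_ln R n n1.
pose q : R := 16 * c * sigma.
pose pair w := (x w, label sigma beta (x w) (eps w)).
pose eta : R := (n ^ 2)%:R^-1.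
(* [margin_violated_ge] with m = n: the cone costs at most 8p/n <= phi1 * sigma,
   because ln n >= 1/2. *)
have wrong_ge (g : p.-tuple R) : 1 <= dot g g ->
    (q%:E <= P0 (pair @^-1` margin_violated g eta))%E.
  move=> g1; apply: (le_trans _ (margin_violated_ge P0 x eps nx neps x_eps sigma eta n%:R
    beta g _ beta1 g1 _ nR0)); last 2 first.
  - by rewrite sigma0.
  - by rewrite invr_ge0.
  rewrite lee_fin -/phi1 -/phi3 /q /c.
  have -> : 16 * (phi1 * phi3 / 16) * sigma = phi3 * (phi1 * sigma) by field.
  rewrite ler_wpM2l ?(ltW phi3_gt0)//.
  rewrite /eta natrX.
  have -> : 2 * ((n%:R ^+ 2)^-1 * (p%:R * n%:R)) = 2 * (p%:R / n%:R) :> R.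
    by field; rewrite gt_eqF.
  have pn2 : p%:R * (6 / n%:R ^+ 2) <= 6 * (p%:R / n%:R) :> R.
    rewrite [leLHS]mulrCA ler_pM2l// ler_wpM2l ?ler0n//.
    by rewrite lef_pV2 ?posrE ?exprn_gt0// expr2 ler_peMr ?ler1n// ltW.
  have pn8 : 8 * (p%:R / n%:R) <= phi1 * sigma.
    rewrite mulrA ler_pdivrMr//.
    apply: (@le_trans _ _ (16 * (p%:R * ln n%:R + t))).
      have : p%:R * 2^-1 <= p%:R * ln n%:R :> R by rewrite ler_wpM2l ?ler0n.
      lra.
    apply: (@le_trans _ _ (16 * (c * sigma * n%:R))); first by rewrite ler_pM2l.
    have -> : 16 * (c * sigma * n%:R) = phi1 * sigma * n%:R * phi3.
      by rewrite /c; field.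
    by rewrite ler_piMr// !mulr_ge0// ltW.
  lra.
have mpair : measurable_fun [set: Omega0] pair.
  by apply: measurable_fun_pair => //; exact: measurable_label.
pose ok f i := data i @^-1` (~` margin_violated (grid (n ^ 2) f : p.-tuple R) eta).
have mok f i : measurable (ok f i).
  rewrite -[X in measurable X]setTI.
  have mdi : measurable_fun [set: Omega] (data i) by [].
  by apply: mdi => //; apply: measurableC; exact: measurable_margin_violated.
have ok_le f i : 1 <= dot (grid (n ^ 2) f : p.-tuple R) (grid (n ^ 2) f) ->
    (0 <= P (ok f i) <= (expR (- q))%:E)%E.
  move=> g1; apply/andP; split; first exact: measure_ge0.
  have mv := measurable_margin_violated (grid (n ^ 2) f : p.-tuple R) eta.
  rewrite /ok (data_law i _ (measurableC mv)).
  rewrite -/pair preimage_setC probability_setC; last first.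
    by have := mpair measurableT _ mv; rewrite setTI.
  apply: (@le_trans _ _ (1 - q%:E)%E); first by rewrite leeB// wrong_ge.
  by rewrite -EFinB lee_fin; exact: expR_ge1Dx.
(* Grid points of norm less than 1 do not arise from rounding a separator. *)
pose Q f := if 1 <= dot (grid (n ^ 2) f : p.-tuple R) (grid (n ^ 2) f)
  then \bigcap_(i in [set` [set: 'I_n]%SET]) ok f i else set0.
have mQ f : measurable (Q f).
  rewrite /Q; case: ifP => // _; apply: fin_bigcap_measurable => //.
have PQ f : (P (Q f) <= (expR (- q) ^+ n)%:E)%E.
  rewrite /Q; case: ifP => [g1|_]; last by rewrite measure0 lee_fin exprn_ge0// expR_ge0.
  rewrite /ok data_indep; last by move=> i; apply: measurableC; exact: measurable_margin_violated.
  rewrite -[X in _ ^+ X]card_ord; apply: prode_le_exp => i; exact: ok_le.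
apply: (@le_trans _ _ (P (\big[setU/set0]_(f <- enum {ffun 'I_p -> 'I_(2 * n ^ 2).+1}) Q f))).
  apply: le_measure; rewrite ?inE.
  - by apply: measurable_linearly_separable => i.
  - exact: bigsetU_measurable.
  move=> w /= /(separable_grid (n ^ 2)); rewrite expn_gt0 n0 => /(_ isT isT)[f [g1 fok]].
  rewrite -bigcup_seq; exists f; first by rewrite /= mem_enum.
  by rewrite /Q g1 => i _; exact: fok.
apply: (le_trans (probability_bigsetU_le _ _ _ _ mQ PQ)).
rewrite lee_fin -cardE.
apply: (@le_trans _ _ (expR (4 * (p%:R * ln n%:R)) * expR (- q) ^+ n)).
  by rewrite ler_wpM2r ?exprn_ge0 ?expR_ge0// grid_card_le.
rewrite -expRM_natl -expRD.
apply: (@le_trans _ _ (expR (- t))).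
  rewrite ler_expR.
  have -> : n%:R * - q = - (16 * (c * sigma * n%:R)) by rewrite /q; lra.
  have : 0 <= p%:R * ln n%:R :> R by rewrite mulr_ge0//; lra.
  lra.
by have := expR_ge0 (- t); lra.
Qed.
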